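(* Let $n\ge 1$ and let $x_1,\dots,x_n,\lambda$ be indeterminates. Then \[\prod_{1\le i<j\le n}(x_i+\lambda x_j)=\sum_{\alpha\in Y_n(\{b,r,g,y\})}\lambda^{E(\alpha)}\prod_{i=1}^{n-1}x_i^{\,n-i-E_i(\alpha)}\sum_{\alpha'}\ \prod_{d=2}^{n}x_d^{E^d(\alpha')},\] where the inner sum is over all row shuffles $\alpha'$ of $\alpha$. Moreover, \[(1+\lambda)^{\binom n2}=\sum_{\alpha\in Y_n(\{b,r,g,y\})}\lambda^{E(\alpha)}\prod_{1\le i\le k\le n-1}\binom{C_{i+1,k}(\alpha)}{E_{i,k}(\alpha)}.\]
   Context: For a set $S\subseteq\{r,b,y\}$, let $Y_n(S\cup\{g\})$ be the set of integer arrays $\alpha=(\alpha_{i,j})$, $1\le i\le n$, $0\le j\le n-i$, with $i\le\alpha_{i,j}\le i+j$ and satisfying, whenever the entries involved are defined: if $r\in S$, $\alpha_{i,j}\le\alpha_{i-1,j+1}+1$; if $b\in S$, $\alpha_{i,j}\le\alpha_{i+1,j-1}$; if $y\in S$, $\alpha_{i,j}\le\alpha_{i,j+1}$. So $Y_n(\{b,r,g,y\})$ uses all three conditions and $Y_n(\{b,r,g\})$ omits the last. A row shuffle of $\alpha\in Y_n(\{b,r,g,y\})$ is an array $\alpha'$ obtained by reordering the entries within each row of $\alpha$ such that $\alpha'\in Y_n(\{b,r,g\})$ (distinct arrays counted once). For an entry $\alpha_{i,j}$ with $j\ge 1$, its southwest diagonal neighbor is $\alpha_{i+1,j-1}$.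 $E_{i,k}(\alpha)$ is the number of entries of value $k$ in row $i$ equal to their southwest diagonal neighbor; $E_i(\alpha)=\sum_k E_{i,k}(\alpha)$; $E(\alpha)=\sum_i E_i(\alpha)$; $E^d(\alpha)$ is the number of entries $\alpha_{i,j}$ with $j\ge1$ and $i+j=d$ equal to their southwest diagonal neighbor; $C_{i,k}(\alpha)$ is the number of entries in row $i$ with value $k$. *)

(* Defs.v *)
From mathcomp Require Import all_boot all_order all_fingroup all_algebra.
From mathcomp.multinomials Require Import mpoly.

Set Implicit Arguments.
Unset Strict Implicit.
Unset Printing Implicit Defensive.

Import GRing.Theory.
Local Open Scope ring_scope.

(* Positions (i, j) with 1 <= i <= n and 0 <= j <= n - i.                     *)
Definition cell (n : nat) : Type :=
  {p : 'I_n.+1 * 'I_n.+1 | (1 <= p.1)%N && (p.1 + p.2 <= n)%N}.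

Definition row_of (n : nat) (c : cell n) : nat := (val c).1.
Definition col_of (n : nat) (c : cell n) : nat := (val c).2.

(* Since i <= alpha_(i,j) <= i + j <= n, letting the entries range over       *)
(* {0, ..., n} instead of all integers loses no array.                        *)
Definition array (n : nat) : Type := {ffun cell n -> 'I_n.+1}.

Section Arrays.
Variable n : nat.
Implicit Types (c : cell n) (a : array n).

Definition entry a c : nat := a c.

(* c' is the southwest diagonal neighbor of c; every cell in a column j >= 1  *)
(* has exactly one, and a cell in column 0 has none.                          *)
Definition southwest c c' : bool :=
  (row_of c' == (row_of c).+1)%N && (col_of c == (col_of c').+1)%N.

Definition right_neighbor c c' : bool :=
  (row_of c' == row_of c)%N && (col_of c' == (col_of c).+1)%N.

Definition green a : bool :=
  [forall c, (row_of c <= entry a c <= row_of c + col_of c)%N].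

Definition red a : bool :=
  [forall c, forall c', southwest c' c ==> (entry a c <= entry a c' + 1)%N].

Definition blue a : bool :=
  [forall c, forall c', southwest c c' ==> (entry a c <= entry a c')%N].

Definition yellow a : bool :=
  [forall c, forall c', right_neighbor c c' ==> (entry a c <= entry a c')%N].

Definition Y_brg : {set array n} := [set a | [&& blue a, red a & green a]].

Definition Y_brgy : {set array n} :=
  [set a | [&& blue a, red a, green a & yellow a]].

Definition row_shuffle a a' : bool :=
  [exists s : {perm cell n},
     [forall c, row_of (s c) == row_of c] &&
     [forall c, entry a' c == entry a (s c)]]
  && (a' \in Y_brg).

Definition eq_southwest a c : bool :=
  [exists c', southwest c c' && (entry a c == entry a c')].

Definition E_rowval a (i k : nat) : nat :=
  #|[set c | [&& row_of c == i, entry a c == k & eq_southwest a c]]|.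

Definition E_row a (i : nat) : nat := (\sum_(k < n.+1) E_rowval a i k)%N.

Definition E_total a : nat := (\sum_(1 <= i < n.+1) E_row a i)%N.

Definition E_diag a (d : nat) : nat :=
  #|[set c | (row_of c + col_of c == d)%N && eq_southwest a c]|.

Definition C_rowval a (i k : nat) : nat :=
  #|[set c | (row_of c == i) && (entry a c == k)]|.

End Arrays.

Arguments Y_brg n : clear implicits.
Arguments Y_brgy n : clear implicits.

(* The n + 1 indeterminates: lambda is number 0 and x_d is number d, for      *)
(* 1 <= d <= n.                                                               *)
Definition lambda (n : nat) : {mpoly int[n.+1]} := 'X_ord0.
Definition x_ (n d : nat) : {mpoly int[n.+1]} := 'X_(inord d).

(* Main.v *)
(* An array of Y_n({b,r,g}) is a free choice, for every cell in a column       *)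
(* j >= 1, of whether its entry equals its southwest neighbor or is one less:  *)
(* entries are then computed from the left end of each diagonal, where the     *)
(* value is forced.  Cell (i, j) stands for the pair i < i + j, so expanding   *)
(* the product of the x_i + lambda x_j sums over these arrays.  Sorting the    *)
(* rows preserves interlacing, hence sends Y_n({b,r,g}) onto                   *)
(* Y_n({b,r,g,y}), with the row shuffles as fibers; E_(i,k) is constant on a   *)
(* fiber because it is determined by the row contents, through                 *)
(*   C_(i,k) + E_(i,k+1) = [i = k] + E_(i,k) + C_(i+1,k+1).                    *)
(* Conversely the E_(i,k) determine the contents, so a row shuffle is built    *)
(* from the bottom row up by choosing, above the C_(i+1,k) entries k of row    *)
(* i + 1, the E_(i,k) places where row i repeats them.                         *)

Require Import Defs.
From mathcomp Require Import all_boot all_order all_fingroup all_algebra.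
From mathcomp Require Import zify.
From mathcomp.multinomials Require Import mpoly.
Set Implicit Arguments.
Unset Strict Implicit.
Unset Printing Implicit Defensive.

(** Expanding the product chooses, for every pair i < j, the term x_i or lambda x_j. With the pair
    placed at the cell (i, j - i) of [inner n], the pairs where lambda x_j is chosen become the
    cells at which an array equals its southwest neighbor. [sum_brg] makes this a bijection with
    [Y_brg n], and [tournament_expansion] reads off the monomial: each equality removes one x_i from
    row i and gives one x_d to diagonal d.

    It remains to group these arrays by row contents. Sorting stays in the class ([sort_rows_brgy]),
    so each group has exactly one representative in [Y_brgy n] ([sum_row_shuffle]). By [C_rec] the
    contents determine E ([E_rowval_shuffle]), so the factors depending on E leave the inner sum,
    which gives the first identity.

    For the second, every x_i becomes 1 and a group contributes its size. By [C_rec] again, E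
    determines the contents ([C_rowval_eq]), so a group is the set of choices with prescribed E.
    [card_fitting] counts these from the bottom row up: the cells of a row are grouped by the value
    of their southwest neighbor, and the choices in distinct groups are independent. *)

(** * Cells, entries and the defining inequalities *)

Lemma big_cell (R : Type) (idx : R) (op : Monoid.com_law idx) n
    (P : nat -> nat -> bool) (F : nat -> nat -> R) :
  \big[op/idx]_(c : cell n | P (row_of c) (col_of c)) F (row_of c) (col_of c)
  = \big[op/idx]_(1 <= i < n.+1)
      \big[op/idx]_(0 <= j < (n - i).+1 | P i j) F i j.
Proof.
transitivity (\big[op/idx]_(p : 'I_n.+1 * 'I_n.+1 |
    (1 <= p.1) && ((p.1 + p.2 <= n) && P p.1 p.2)) F p.1 p.2).
  rewrite [RHS](reindex_omap (val : cell n -> _) insub) => [|p Hp].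
    apply: eq_bigl => c; rewrite valK eqxx andbT andbA.
    by have := valP c; rewrite /= => ->.
  by rewrite insubT //=; move: Hp; rewrite andbA => /andP[].
rewrite -(pair_big_dep (fun i : 'I_n.+1 => 1 <= i)
  (fun i j : 'I_n.+1 => (i + j <= n) && P i j) (fun i j => F i j)) /=.
rewrite big_geq_mkord /=; apply: eq_bigr => i Hi.
rewrite big_mkord (big_ord_widen_cond n.+1 (P i) (F i)); last lia.
by apply: eq_bigl => j; rewrite andbC; congr (_ && _); have := ltn_ord i; lia.
Qed.

Lemma cell_at n i j : 0 < i -> i + j <= n ->
  exists c : cell n, row_of c = i /\ col_of c = j.
Proof.
move=> i0 ijn.
have Hi : i < n.+1 by lia.
have Hj : j < n.+1 by lia.
pose good (p : 'I_n.+1 * 'I_n.+1) := (1 <= p.1) && (p.1 + p.2 <= n).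
have H : good (Ordinal Hi, Ordinal Hj) by rewrite /good /= i0.
by exists (exist good _ H).
Qed.

Lemma cell_bounds n (c : cell n) : (0 < row_of c) && (row_of c + col_of c <= n).
Proof. exact: (valP c). Qed.

Lemma cell_inj n (c c' : cell n) :
  row_of c = row_of c' -> col_of c = col_of c' -> c = c'.
Proof.
move=> Hr Hc; apply/val_inj; move: Hr Hc; rewrite /row_of /col_of.
by case: (val c) (val c') => [i j] [i' j'] /= /val_inj -> /val_inj ->.
Qed.

Section CellFunction.
Variables (n : nat) (T : Type) (x0 : T).

(* [x0] outside the triangle. *)
Definition at_ (f : cell n -> T) (i j : nat) : T :=
  oapp f x0 [pick c | (row_of c == i) && (col_of c == j)].

Lemma at_cell (f : cell n -> T) c : at_ f (row_of c) (col_of c) = f c.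
Proof.
rewrite /at_; case: pickP => [d /andP[/eqP Hr /eqP Hc] /= |/(_ c)]; last by rewrite !eqxx.
by rewrite (cell_inj Hr Hc).
Qed.

End CellFunction.

(** Reading entries at integer coordinates turns neighbors into index shifts. *)
Definition ev n (a : array n) : nat -> nat -> nat := at_ 0 (entry a).

Lemma ev_cell n (a : array n) c : ev a (row_of c) (col_of c) = entry a c.
Proof. exact: at_cell. Qed.

Section Conditions.
Variables (n : nat) (a : array n).

Lemma greenP : reflect
  (forall i j, 0 < i -> i + j <= n -> i <= ev a i j <= i + j) (green a).
Proof.
apply: (iffP forallP) => [H i j i0 ijn | H c].
  by have [c [<- <-]] := cell_at i0 ijn; rewrite ev_cell.
by rewrite -ev_cell; have /andP[] := cell_bounds c; apply: H.
Qed.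

Lemma blueP : reflect
  (forall i j, 0 < i -> i.+1 + j <= n -> ev a i j.+1 <= ev a i.+1 j) (blue a).
Proof.
apply: (iffP forallP) => [H i j i0 ijn | H c].
  have [c [Hi Hj]] := @cell_at n i j.+1 i0 ltac:(lia).
  have [c' [Hi' Hj']] := @cell_at n i.+1 j isT ijn.
  have /forallP/(_ c')/implyP := H c.
  by rewrite /southwest -!ev_cell Hi Hj Hi' Hj'; apply; rewrite !eqxx.
apply/forallP=> c'; apply/implyP => /andP[/eqP Hr /eqP Hc].
rewrite -!ev_cell Hr Hc; have := cell_bounds c; have := cell_bounds c'.
by move=> ? ?; apply: H; lia.
Qed.

Lemma redP : reflect
  (forall i j, 0 < i -> i.+1 + j <= n -> ev a i.+1 j <= (ev a i j.+1).+1) (red a).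
Proof.
apply: (iffP forallP) => [H i j i0 ijn | H c].
  have [c [Hi Hj]] := @cell_at n i j.+1 i0 ltac:(lia).
  have [c' [Hi' Hj']] := @cell_at n i.+1 j isT ijn.
  have /forallP/(_ c)/implyP := H c'.
  by rewrite /southwest -!ev_cell Hi Hj Hi' Hj' addn1; apply; rewrite !eqxx.
apply/forallP=> c'; apply/implyP => /andP[/eqP Hr /eqP Hc].
rewrite -!ev_cell Hr Hc addn1; have := cell_bounds c; have := cell_bounds c'.
by move=> ? ?; apply: H; lia.
Qed.

Lemma yellowP : reflect
  (forall i j, 0 < i -> i + j.+1 <= n -> ev a i j <= ev a i j.+1) (yellow a).
Proof.
apply: (iffP forallP) => [H i j i0 ijn | H c].
  have [c [Hi Hj]] := @cell_at n i j i0 ltac:(lia).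
  have [c' [Hi' Hj']] := @cell_at n i j.+1 i0 ijn.
  have /forallP/(_ c')/implyP := H c.
  by rewrite /right_neighbor -!ev_cell Hi Hj Hi' Hj'; apply; rewrite !eqxx.
apply/forallP=> c'; apply/implyP => /andP[/eqP Hr /eqP Hc].
rewrite -!ev_cell Hr Hc; have := cell_bounds c; have := cell_bounds c'.
by move=> ? ?; apply: H; lia.
Qed.

(** The southwest neighbor is unique, so the existential reduces to one equation; the guard keeps
    [.-1] from truncating. *)
Lemma eq_southwestE c : eq_southwest a c =
  (0 < col_of c) && (entry a c == ev a (row_of c).+1 (col_of c).-1).
Proof.
apply/existsP/andP => [[c' /andP[/andP[/eqP Hr /eqP Hc] /eqP He]] | [c0 /eqP He]].
  by rewrite Hc -Hr /= ev_cell He.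
have := cell_bounds c => cb.
have [c' [Hi Hj]] := @cell_at n (row_of c).+1 (col_of c).-1 isT ltac:(lia).
exists c'; rewrite /southwest Hi Hj prednK // !eqxx /=.
by rewrite -(ev_cell a c') Hi Hj He.
Qed.
End Conditions.

Lemma ev_inj n (a a' : array n) :
  (forall i j, 0 < i -> i + j <= n -> ev a i j = ev a' i j) -> a = a'.
Proof.
move=> H; apply/ffunP => c; apply/val_inj; change (entry a c = entry a' c).
by rewrite -!ev_cell; have /andP[] := cell_bounds c; apply: H.
Qed.

(** * Row statistics *)

(** Applied to the pairs (row, entry), this replaces the permutation in [row_shuffle] by equality of
    all the [C_rowval]. Equal fiber sizes make the two lists of values permutations of each other,
    and [enum_rank] carries the permutation of positions over to [T]. *)
Lemma fiber_permP (T : finType) (K : eqType) (f g : T -> K) :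
  (forall k, #|[set x | f x == k]| = #|[set x | g x == k]|) <->
  exists s : {perm T}, forall x, g x = f (s x).
Proof.
split=> [H | [s Hs] k]; last first.
  rewrite -(card_preimset _ (@perm_inj _ s)).
  by apply: eq_card => x; rewrite !inE Hs.
have cnt (h : T -> K) k : count_mem k (codom_tuple h) = #|[set x | h x == k]|.
  rewrite cardsE cardE /enum_mem size_filter /= /codom /image_mem count_map enumT
    /=; exact: eq_count.
have /tuple_permP[p Hp] : perm_eq (codom_tuple g) (codom_tuple f).
  by apply/allP => k _ /=; rewrite !cnt H.
have pi : injective (fun x : T => enum_val (p (enum_rank x)) : T).
  by apply: (inj_comp enum_val_inj); apply: (inj_comp perm_inj enum_rank_inj).
exists (perm pi) => x; rewrite permE.
have /(congr1 (fun s => nth (g x) s (enum_rank x))) := Hp.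
rewrite nth_codom enum_rankK (nth_map (enum_rank x)) ?size_enum_ord //.
by rewrite nth_ord_enum (tnth_nth (f x)) /= nth_codom => ->.
Qed.

Lemma card_row n i (P : nat -> bool) : 0 < i -> i <= n ->
  #|[set c : cell n | (row_of c == i) && P (col_of c)]| =
  \sum_(0 <= j < (n - i).+1) P j.
Proof.
move=> i0 ilen; rewrite -sum1dep_card.
rewrite (big_cell _ _ (fun i' j => (i' == i) && P j) (fun _ _ => 1)).
rewrite (bigD1_seq i) ?mem_index_iota ?iota_uniq //=; last lia.
rewrite [X in _ + X]big1 => [|i' /negbTE ->]; last by rewrite big_pred0.
by rewrite addn0 eqxx big_mkcond; apply: eq_bigr => j _; case: (P j).
Qed.

Section Statistics.
Variables (n : nat) (a : array n).

Lemma C_rowvalE i k : 0 < i -> i <= n ->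
  C_rowval a i k = \sum_(0 <= j < (n - i).+1) (ev a i j == k).
Proof.
move=> i0 ilen; rewrite -card_row //; apply: eq_card => c; rewrite !inE.
by case: eqP => //= <-; rewrite ev_cell.
Qed.

Lemma E_rowvalE i k : 0 < i -> i <= n ->
  E_rowval a i k =
  \sum_(0 <= j < n - i) ((ev a i j.+1 == k) && (ev a i.+1 j == k)).
Proof.
move=> i0 ilen.
transitivity (\sum_(0 <= j < (n - i).+1)
    [&& 0 < j, ev a i j == k & ev a i.+1 j.-1 == k]).
  rewrite -card_row //; apply: eq_card => c; rewrite !inE eq_southwestE.
  case: eqP => //= <-; rewrite ev_cell [RHS]andbCA; case: eqP => //= <-.
  by rewrite eq_sym.
by rewrite big_nat_recl // add0n.
Qed.

Lemma E_rowval_small i k : (i == 0) || (n <= i) -> E_rowval a i k = 0.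
Proof.
move=> Hi; apply/eqP; rewrite cards_eq0; apply/eqP/setP => c; rewrite !inE.
rewrite eq_southwestE; have := cell_bounds c; move: Hi; case: eqP => //=; lia.
Qed.

Lemma E_rowval_big i k : n < k -> E_rowval a i k = 0.
Proof.
move=> Hk; apply/eqP; rewrite cards_eq0; apply/eqP/setP => c; rewrite !inE.
by have := ltn_ord (a c); rewrite /entry; lia.
Qed.

Lemma C_rowval_small i k : (i == 0) || (n < i) -> C_rowval a i k = 0.
Proof.
move=> Hi; apply/eqP; rewrite cards_eq0; apply/eqP/setP => c; rewrite !inE.
by have := cell_bounds c; lia.
Qed.

Hypothesis aY : a \in Y_brg n.

Lemma Y_brg_green i j : 0 < i -> i + j <= n -> i <= ev a i j <= i + j.
Proof. by move: aY; rewrite inE => /and3P[_ _ /greenP]; apply. Qed.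

Lemma Y_brg_col0 i : 0 < i -> i <= n -> ev a i 0 = i.
Proof. by move=> i0 ilen; have := @Y_brg_green i 0 i0; lia. Qed.

Lemma Y_brg_step i j : 0 < i -> i.+1 + j <= n ->
  ev a i j.+1 <= ev a i.+1 j <= (ev a i j.+1).+1.
Proof.
move=> i0 ijn; move: aY; rewrite inE => /and3P[/blueP Hb /redP Hr _].
by rewrite Hb ?Hr.
Qed.

(* Row [i] consists of [i] and, for each entry [v] of row [i.+1], either [v]
   (counted by E) or [v.-1]. *)
Lemma C_rec i k : 0 < i -> i < n ->
  C_rowval a i k + E_rowval a i k.+1 =
  (i == k) + E_rowval a i k + C_rowval a i.+1 k.+1.
Proof.
move=> i0 iltn; rewrite !C_rowvalE ?E_rowvalE //; try lia.
rewrite big_nat_recl // Y_brg_col0 // -?addnA; last lia.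
congr (_ + _); rewrite -subSn // subSS -!big_split /=.
apply: eq_big_nat => j Hj; have := @Y_brg_step i j i0 ltac:(lia).
by lia.
Qed.
End Statistics.

Lemma row_shuffleP n (a a' : array n) : reflect
  ((forall i k, C_rowval a i k = C_rowval a' i k) /\ a' \in Y_brg n)
  (row_shuffle a a').
Proof.
have fib (b : array n) i k :
    C_rowval b i k = #|[set c | (row_of c, entry b c) == (i, k)]|.
  by apply: eq_card => c; rewrite !inE.
apply: (iffP andP) => [[/existsP[s /andP[/forallP Hr /forallP He]] ->] | [H ->]];
  split=> //.
- move=> i k; rewrite !fib.
  move: {i k}(i, k); apply/fiber_permP; exists s => c.
  by rewrite (eqP (Hr c)) (eqP (He c)).
have /fiber_permP[s Hs] : forall ik : nat * nat,
    #|[set c | (row_of c, entry a c) == ik]| =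
    #|[set c | (row_of c, entry a' c) == ik]|.
  by case=> i k; rewrite -!fib.
by apply/existsP; exists s; apply/andP; split; apply/forallP => c;
   case: (Hs c) => /eqP; rewrite eq_sym // => _ ->.
Qed.

(** [C_rec] gives E at k from E at k + 1 and the contents; the induction runs down from k > n, where
    E vanishes. *)
Lemma E_rowval_shuffle n (a a' : array n) :
  a \in Y_brg n -> a' \in Y_brg n ->
  (forall i k, C_rowval a i k = C_rowval a' i k) ->
  forall i k, E_rowval a i k = E_rowval a' i k.
Proof.
move=> aY a'Y HC i k.
have [Hi | Hi] := boolP ((i == 0) || (n <= i)); first by rewrite !E_rowval_small.
have [m] := ubnP (n.+1 - k); elim: m k => // m IH k Hm.
have [Hk | Hk] := ltnP n k; first by rewrite !E_rowval_big.
have := C_rec aY k; have := C_rec a'Y k.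
move=> /(_ i ltac:(lia) ltac:(lia)) + /(_ i ltac:(lia) ltac:(lia)).
by rewrite !HC (IH k.+1) //; lia.
Qed.

(** [C_rec] solved the other way: the contents of row i follow from those of row i + 1 and from E in
    row i, and row n is the single entry n. The cutoff [t] serves partial constructions, where E is
    prescribed only from row [t] on. *)
Lemma C_rowval_eq n (a a' : array n) t : 0 < t ->
  a \in Y_brg n -> a' \in Y_brg n ->
  (forall i k, t <= i -> E_rowval a i k = E_rowval a' i k) ->
  forall i k, t <= i -> C_rowval a i k = C_rowval a' i k.
Proof.
move=> t0 aY a'Y HE i k; have [m] := ubnP (n.+1 - i).
elim: m i k => // m IH i k Hm ti.
have [Hi | Hi] := ltnP n i; first by rewrite !C_rowval_small // Hi orbT.
have [Hn | Hn] := eqVneq i n.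
  rewrite !C_rowvalE //; try lia.
  by rewrite Hn subnn !big_nat1 !Y_brg_col0 //; lia.
have := C_rec aY k; have := C_rec a'Y k.
move=> /(_ i ltac:(lia) ltac:(lia)) + /(_ i ltac:(lia) ltac:(lia)).
by rewrite !(IH i.+1) ?HE //; lia.
Qed.

(** * Sorting the rows *)

(** In a sorted list the entries at most k form an initial segment. *)
Lemma nth_sorted_le (s : seq nat) j k : sorted leq s -> j < size s ->
  (nth 0 s j <= k) = (j < count (leq^~ k) s).
Proof.
move=> ss js; apply/idP/idP => H; last first.
  exact: (Order.PreorderTheory.nth_count_le 0 (ss : sorted <=%O s) H).
rewrite ltnNge; apply/negP => H'.
have := @Order.TotalTheory.DualTotalTheory.nth_count_gt _ nat k 0 s j ss.
by rewrite H' js Order.NatOrder.ltEnat /= => /(_ isT); rewrite ltnNge H.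
Qed.

Section RowSort.
Variables (n : nat) (a : array n).

Definition row_seq i : seq nat := mkseq (ev a i) (n - i).+1.

Lemma count_row_seq i (P : pred nat) :
  count P (row_seq i) = \sum_(0 <= j < (n - i).+1) P (ev a i j).
Proof. by rewrite -sum1_count big_map big_mkcond. Qed.

Lemma C_rowval_count i k : 0 < i -> i <= n ->
  C_rowval a i k = count_mem k (row_seq i).
Proof. by move=> i0 ilen; rewrite C_rowvalE // count_row_seq. Qed.

Definition sort_rows : array n :=
  [ffun c => inord (nth 0 (sort leq (row_seq (row_of c))) (col_of c))].

Lemma ev_le i j : ev a i j <= n.
Proof.
rewrite /ev /at_; case: pickP => //= c _; have := ltn_ord (a c).
by rewrite ltnS.
Qed.

Lemma ev_sort_rows i j : 0 < i -> i + j <= n ->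
  ev sort_rows i j = nth 0 (sort leq (row_seq i)) j.
Proof.
move=> i0 ijn; have [c [<- Hj]] := cell_at i0 ijn.
rewrite -Hj ev_cell /entry ffunE inordK // ltnS.
have: nth 0 (sort leq (row_seq (row_of c))) (col_of c) \in row_seq (row_of c).
  rewrite -(mem_sort leq) mem_nth // size_sort size_mkseq.
  by have := cell_bounds c; lia.
by case/mapP => j' _ ->; apply: ev_le.
Qed.

End RowSort.

Lemma row_seq_sort_rows n (a : array n) i : 0 < i -> i <= n ->
  row_seq (sort_rows a) i = sort leq (row_seq a i).
Proof.
move=> i0 ilen; apply: (@eq_from_nth _ 0); first by rewrite size_sort !size_mkseq.
rewrite size_mkseq => j Hj; rewrite nth_mkseq // ev_sort_rows //; lia.
Qed.

Lemma C_rowval_sort_rows n (a : array n) i k :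
  C_rowval (sort_rows a) i k = C_rowval a i k.
Proof.
have [Hi | Hi] := boolP ((i == 0) || (n < i)); first by rewrite !C_rowval_small.
rewrite !C_rowval_count ?row_seq_sort_rows //; try lia.
by apply/seq.permP; rewrite perm_sort.
Qed.

(** Bounds on the sorted array become counts in the unsorted one, where the inequalities of [Y_brg]
    apply cell by cell. *)
Lemma sort_rows_le n (a : array n) i j k : 0 < i -> i + j <= n ->
  (ev (sort_rows a) i j <= k) =
  (j < \sum_(0 <= j' < (n - i).+1) (ev a i j' <= k)).
Proof.
move=> i0 ijn; rewrite ev_sort_rows // nth_sorted_le.
- rewrite -(count_row_seq _ _ (leq^~ k)); congr (_ < _).
  by apply/seq.permP; rewrite perm_sort.
- exact: sort_sorted leq_total _.
- by rewrite size_sort size_mkseq; lia.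
Qed.

Section SortInY.
Variables (n : nat) (a : array n).
Hypothesis aY : a \in Y_brg n.

Lemma sort_rows_ge i j : 0 < i -> i + j <= n -> i <= ev (sort_rows a) i j.
Proof.
move=> i0 ijn; rewrite leqNgt; apply/negP => H.
have : ev (sort_rows a) i j <= i.-1 by lia.
rewrite sort_rows_le // big_nat big1 // => j' Hj'.
by have := @Y_brg_green _ _ aY i j' i0 ltac:(lia); lia.
Qed.

(** For blue and red, numbers of small entries in adjacent rows are compared. Row i has one entry
    more than row i + 1, its forced first entry i ([splitrow]), which absorbs the column shift
    between a cell and its southwest neighbor. *)
Lemma sort_rows_brgy : sort_rows a \in Y_brgy n.
Proof.
have splitrow i k : 0 < i -> i < n ->
    \sum_(0 <= j < (n - i).+1) (ev a i j <= k) =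
    (i <= k) + \sum_(0 <= j < (n - i.+1).+1) (ev a i j.+1 <= k).
  move=> i0 iltn; rewrite big_nat_recl // (Y_brg_col0 aY) //; last lia.
  by rewrite -subSn // subSS.
rewrite inE; apply/and4P; split.
- apply/blueP => i j i0 ijn; rewrite sort_rows_le //; last lia.
  set k := ev _ i.+1 j.
  have ik : i < k by apply: sort_rows_ge => //.
  have : k <= k by []; rewrite {1}/k sort_rows_le // => /leq_trans Hj.
  rewrite splitrow // ?(ltnW ik) ?add1n ?ltnS; last lia.
  apply: Hj; rewrite !big_nat; apply: leq_sum => j' Hj'.
  by have := @Y_brg_step _ _ aY i j' i0 ltac:(lia); lia.
- apply/redP => i j i0 ijn; rewrite sort_rows_le //.
  set k := ev _ i j.+1.
  have : k <= k by []; rewrite {1}/k sort_rows_le //; last lia.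
  rewrite splitrow //; last lia.
  have: \sum_(0 <= j' < (n - i.+1).+1) (ev a i j'.+1 <= k) <=
        \sum_(0 <= j' < (n - i.+1).+1) (ev a i.+1 j' <= k.+1).
    rewrite !big_nat; apply: leq_sum => j' Hj'.
    by have := @Y_brg_step _ _ aY i j' i0 ltac:(lia); lia.
  by lia.
- apply/greenP => i j i0 ijn; rewrite sort_rows_ge // sort_rows_le //.
  (* Already the first j + 1 unsorted entries are at most i + j. *)
  rewrite (big_cat_nat _ (n := j.+1)) //=; last lia.
  apply: leq_trans (leq_addr _ _).
  rewrite big_nat (eq_bigr (fun _ => 1)) => [|j' Hj'].
    by rewrite -big_nat sum_nat_const_nat subn0 muln1.
  by have := @Y_brg_green _ _ aY i j' i0 ltac:(lia); lia.
apply/yellowP => i j i0 ijn; rewrite !ev_sort_rows //; last lia.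
have /(sortedP 0) := sort_sorted leq_total (row_seq a i).
by apply; rewrite size_sort size_mkseq; lia.
Qed.
End SortInY.

Lemma Y_brgy_sub n (a : array n) : a \in Y_brgy n -> a \in Y_brg n.
Proof. by rewrite !inE => /and4P[-> -> ->]. Qed.

Lemma Y_brgy_inj n (a a' : array n) : a \in Y_brgy n -> a' \in Y_brgy n ->
  (forall i k, C_rowval a i k = C_rowval a' i k) -> a = a'.
Proof.
move=> aY a'Y HC.
have ss (b : array n) i : b \in Y_brgy n -> 0 < i -> sorted leq (row_seq b i).
  rewrite inE => /and4P[_ _ _ /yellowP H] i0; apply/(sortedP 0) => j.
  by rewrite size_mkseq => Hj; rewrite !nth_mkseq //; try apply: H => //; lia.
apply: ev_inj => i j i0 ijn.
suff /(congr1 (nth 0 ^~ j)) : row_seq a i = row_seq a' i.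
  by rewrite !nth_mkseq //; lia.
apply: (sorted_eq leq_trans anti_leq); rewrite ?ss //.
apply/allP => k _; apply/eqP; have := HC i k.
by rewrite !C_rowval_count //; lia.
Qed.

Lemma row_shuffle_sort n (a a' : array n) : a' \in Y_brg n -> a \in Y_brgy n ->
  row_shuffle a a' = (a == sort_rows a').
Proof.
move=> a'Y aY; apply/row_shuffleP/eqP => [[HC _] | ->].
  by apply: Y_brgy_inj => //; [apply: sort_rows_brgy | move=> i k; rewrite C_rowval_sort_rows].
by split=> // i k; rewrite C_rowval_sort_rows.
Qed.

(** Each array of [Y_brg n] is a row shuffle of exactly one array of [Y_brgy n], its sorted
    version. *)
Lemma sum_row_shuffle (M : nmodType) n (F : array n -> M) :
  (\sum_(a in Y_brgy n) \sum_(a' | row_shuffle a a') F a' =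
   \sum_(a in Y_brg n) F a)%R.
Proof.
rewrite (exchange_big_dep (mem (Y_brg n))) /=; last first.
  by move=> a a' _ /row_shuffleP[].
apply: eq_bigr => a' a'Y; rewrite (big_pred1 (sort_rows a')) // => a /=.
have [aY | aY] := boolP (a \in Y_brgy n); first by rewrite row_shuffle_sort.
by apply/esym/negbTE; apply: contraNneq aY => ->; apply: sort_rows_brgy.
Qed.

(** * Arrays as sets of cells *)

Definition inner n : {set cell n} := [set c | 0 < col_of c].

Definition eq_cells n (a : array n) : {set cell n} := [set c | eq_southwest a c].

(* The truncated subtraction is exact, since [i.+1 <= descend b i.+1 j']. *)
Fixpoint descend (b : nat -> nat -> bool) i j : nat :=
  if j is j'.+1 then descend b i.+1 j' - ~~ b i j else i.

Definition bits n (B : {set cell n}) : nat -> nat -> bool :=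
  at_ false (fun c => c \in B).

Definition array_of n (B : {set cell n}) : array n :=
  [ffun c => inord (descend (bits B) (row_of c) (col_of c))].

Lemma descend_bounds b i j : i <= descend b i j <= i + j.
Proof. by elim: j i => [|j IH] i /=; [|have := IH i.+1]; lia. Qed.

Lemma descend_ext b b' i j :
  (forall i' j', i <= i' -> b i' j' = b' i' j') ->
  descend b i j = descend b' i j.
Proof.
elim: j i => //= j IH i H; rewrite H // (IH i.+1) // => i' j' ii'.
by rewrite H // ltnW.
Qed.

Lemma ev_array_of n (B : {set cell n}) i j : 0 < i -> i + j <= n ->
  ev (array_of B) i j = descend (bits B) i j.
Proof.
move=> i0 ijn; have [c [Hi Hj]] := cell_at i0 ijn.
rewrite -Hi -Hj ev_cell /entry ffunE inordK // ltnS Hi Hj.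
by have := descend_bounds (bits B) i j; lia.
Qed.

Lemma array_of_brg n (B : {set cell n}) : array_of B \in Y_brg n.
Proof.
rewrite inE; apply/and3P; split.
- by apply/blueP => i j i0 ijn; rewrite !ev_array_of //=; lia.
- by apply/redP => i j i0 ijn; rewrite !ev_array_of //=; lia.
- by apply/greenP => i j i0 ijn; rewrite !ev_array_of // descend_bounds.
Qed.

Lemma array_ofK n (B : {set cell n}) :
  B \subset inner n -> eq_cells (array_of B) = B.
Proof.
move=> /subsetP Binner; apply/setP => c; rewrite inE eq_southwestE.
case Hc: (0 < col_of c) => /=; last first.
  by apply/esym/negbTE; apply: contraFN Hc => /Binner; rewrite inE.
have cb := cell_bounds c.
rewrite -ev_cell !ev_array_of //; try lia.
have <- : bits B (row_of c) (col_of c) = (c \in B) by exact: at_cell.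
case: (col_of c) Hc => //= j _.
by have := descend_bounds (bits B) (row_of c).+1 j; lia.
Qed.

(** Induction along the diagonal: the value in column 0 is forced, and each further entry is its
    southwest neighbor or one less, as the bit says. *)
Lemma eq_cellsK n (a : array n) : a \in Y_brg n -> array_of (eq_cells a) = a.
Proof.
move=> aY; apply: ev_inj => i j i0 ijn; rewrite ev_array_of //.
elim: j i i0 ijn => [|j IH] i i0 ijn /=; first by rewrite (Y_brg_col0 aY) //; lia.
rewrite IH //; last lia.
have [c [Hi Hj]] := cell_at i0 ijn.
have -> : bits (eq_cells a) i j.+1 = eq_southwest a c.
  by rewrite -Hi -Hj /bits at_cell inE.
rewrite eq_southwestE -ev_cell Hi Hj /=.
by have := @Y_brg_step _ _ aY i j i0 ltac:(lia); lia.
Qed.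

Lemma eq_cells_inner n (a : array n) : eq_cells a \subset inner n.
Proof. by apply/subsetP => c; rewrite !inE eq_southwestE => /andP[]. Qed.

Lemma sum_brg (M : nmodType) n (F : {set cell n} -> M) :
  (\sum_(a in Y_brg n) F (eq_cells a) = \sum_(B : {set cell n} | B \subset inner n) F B)%R.
Proof.
rewrite [RHS](reindex_onto (@eq_cells n) (@array_of n)) => [|B /array_ofK //].
apply: eq_bigl => a; rewrite eq_cells_inner /=.
by apply/idP/eqP => [/eq_cellsK // | <-]; rewrite array_of_brg.
Qed.

Lemma big_fiber (R : Type) (idx : R) (op : Monoid.com_law idx) (T : finType)
    (A : {set T}) (f : T -> nat) m p (F : T -> R) :
  (forall c, c \in A -> m <= f c < p) ->
  \big[op/idx]_(c in A) F c =
  \big[op/idx]_(m <= d < p) \big[op/idx]_(c in [set c in A | f c == d]) F c.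
Proof.
move=> Hf; under [RHS]eq_bigr => d _ do
  (under eq_bigl => c do rewrite inE; rewrite big_mkcondr).
rewrite exchange_big /=; apply: eq_bigr => c cA.
rewrite (bigD1_seq (f c)) ?mem_index_iota ?iota_uniq ?Hf //= eqxx.
rewrite big1 ?Monoid.mulm1 // => d; rewrite eq_sym; by case: eqP.
Qed.

Lemma card_fiber (T : finType) (A : {set T}) (f : T -> nat) m p :
  (forall c, c \in A -> m <= f c < p) ->
  #|A| = \sum_(m <= d < p) #|[set c in A | f c == d]|.
Proof.
move=> Hf; rewrite -sum1_card (big_fiber _ _ Hf).
by apply: eq_bigr => d _; rewrite sum1_card.
Qed.

Lemma E_rowE n (a : array n) i :
  E_row a i = #|[set c in eq_cells a | row_of c == i]|.
Proof.
rewrite (@card_fiber _ _ (entry a) 0 n.+1); last by move=> c _; exact: ltn_ord.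
rewrite big_mkord; apply: eq_bigr => k _; apply: eq_card => c; rewrite !inE.
by rewrite [RHS]andbAC [eq_southwest a c && _]andbC [RHS]andbC.
Qed.

Lemma E_totalE n (a : array n) : E_total a = #|eq_cells a|.
Proof.
rewrite (@card_fiber _ _ (@row_of n) 1 n.+1); last first.
  by move=> c _; have := cell_bounds c; lia.
by apply: eq_bigr => i _; rewrite E_rowE.
Qed.

Lemma E_diagE n (a : array n) d :
  E_diag a d = #|[set c in eq_cells a | row_of c + col_of c == d]|.
Proof. by apply: eq_card => c; rewrite !inE andbC. Qed.

Lemma card_inner_row n i : 0 < i -> i <= n ->
  #|[set c in inner n | row_of c == i]| = n - i.
Proof.
move=> i0 ilen.
have -> : [set c in inner n | row_of c == i] =
    [set c | (row_of c == i) && (0 < col_of c)].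
  by apply/setP => c; rewrite !inE andbC.
rewrite card_row // big_nat_recl // big_nat.
by rewrite (eq_bigr (fun _ => 1)) // -big_nat sum_nat_const_nat; lia.
Qed.

Lemma card_inner n : #|inner n| = 'C(n, 2).
Proof.
rewrite (@card_fiber _ _ (@row_of n) 1 n.+1); last first.
  by move=> c _; have := cell_bounds c; lia.
rewrite -bin2_sum big_nat_rev (big_addn 0 n.+1 1) subn1 /=.
by rewrite !big_nat; apply: eq_bigr => i Hi; rewrite card_inner_row; lia.
Qed.

(** * Counting row shuffles *)

(** Such a [D] is the disjoint union of its parts over the values k, and these parts are independent
    choices of [e k] elements from the fibers of [v] in [X]. *)
Lemma card_subset_fibers (T K : finType) (X : {set T}) (v : T -> K)
    (e : K -> nat) :
  #|[set D : {set T} | (D \subset X) &&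
      [forall k, #|[set c in D | v c == k]| == e k]]| =
  \prod_k 'C(#|[set c in X | v c == k]|, e k).
Proof.
pose fibers (D : {set T}) : {ffun K -> {set T}} :=
  [ffun k => [set c in D | v c == k]].
pose Fam k := [set A : {set T} | A \subset [set c in X | v c == k] & #|A| == e k].
have fibersK (D : {set T}) c : (c \in D) = (c \in fibers D (v c)).
  by rewrite ffunE inE eqxx andbT.
have fibers_inj : injective fibers.
  by move=> D D' HD; apply/setP => c; rewrite (fibersK D) (fibersK D') HD.
rewrite -(card_imset _ fibers_inj).
transitivity #|family Fam|; last first.
  rewrite card_family foldrE big_map big_enum /=.
  by apply: eq_bigr => k _; rewrite cards_draws.
apply: eq_card => f; apply/imsetP/familyP => [[D] | Hf].
  rewrite inE => /andP[/subsetP DX /forallP HD] -> k.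
  rewrite !inE ffunE HD andbT; apply/subsetP => c.
  by rewrite !inE => /andP[/DX -> ->].
have Hfk k c : c \in f k -> (c \in X) && (v c == k).
  by have := Hf k; rewrite inE => /andP[/subsetP H _] /H; rewrite inE.
have fE : f = fibers [set c | c \in f (v c)].
  apply/ffunP => k; rewrite ffunE; apply/setP => c; rewrite !inE.
  apply/idP/andP => [ck | [cv /eqP <-] //].
  by have /andP[_ /eqP E] := Hfk _ _ ck; rewrite E ck.
exists [set c | c \in f (v c)] => //; rewrite inE; apply/andP; split.
  by apply/subsetP => c; rewrite inE => /Hfk/andP[].
apply/forallP => k; have := Hf k; rewrite inE => /andP[_].
by rewrite {1}fE ffunE.
Qed.

Lemma bits_ext n (B B' : {set cell n}) t i j :
  (forall c, t <= row_of c -> (c \in B) = (c \in B')) ->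
  t <= i -> bits B i j = bits B' i j.
Proof.
move=> H ti; rewrite /bits /at_; case: pickP => //= c /andP[/eqP Hi _].
by apply: H; rewrite Hi.
Qed.

(** An entry is computed from bits in its own row and lower ones along its diagonal, so choices
    above row [t] do not affect it. *)
Lemma ev_array_of_ext n (B B' : {set cell n}) t i j :
  (forall c, t <= row_of c -> (c \in B) = (c \in B')) ->
  t <= i -> 0 < i -> i + j <= n -> ev (array_of B) i j = ev (array_of B') i j.
Proof.
move=> H ti i0 ijn; rewrite !ev_array_of //; apply: descend_ext => i' j' ii'.
by apply: bits_ext H _; apply: leq_trans ii'.
Qed.

Lemma E_rowval_array_of_ext n (B B' : {set cell n}) t i k :
  (forall c, t <= row_of c -> (c \in B) = (c \in B')) ->
  t <= i -> E_rowval (array_of B) i k = E_rowval (array_of B') i k.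
Proof.
move=> H ti.
have [Hi | Hi] := boolP ((i == 0) || (n <= i)); first by rewrite !E_rowval_small.
rewrite !E_rowvalE; try lia; rewrite !big_nat; apply: eq_bigr => j Hj.
by rewrite !(ev_array_of_ext H) //; lia.
Qed.

(** A cell of [B] repeats its southwest neighbor, so its value can be read in row [t.+1], which is
    independent of the choices in row [t]. *)
Lemma E_rowval_array_of n (B : {set cell n}) t k : B \subset inner n ->
  E_rowval (array_of B) t k =
  #|[set c in B | (row_of c == t) &&
                  (ev (array_of B) t.+1 (col_of c).-1 == k)]|.
Proof.
move=> Binner; apply: eq_card => c; rewrite !inE.
have -> : (c \in B) = eq_southwest (array_of B) c.
  by rewrite -[in LHS](array_ofK Binner) inE.
rewrite eq_southwestE; case: eqP => [<- |_]; rewrite ?andbF //=.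
rewrite andbCA -andbA; case: (0 < _) => //=; rewrite andbC.
by case: eqP => [->|_].
Qed.

Definition inner_from n t : {set cell n} := [set c in inner n | t <= row_of c].

Section CountShuffles.
Variables (n : nat) (a : array n).
Hypothesis aY : a \in Y_brg n.

(* The choices made in rows [>= t] (and none below [t]) that realize the
   statistics E_(i,k) of [a] there. *)
Definition fitting t : {set {set cell n}} :=
  [set B : {set cell n} | (B \subset inner_from n t) &&
    [forall i : 'I_n.+1, forall k : 'I_n.+1,
      (t <= i) ==> (E_rowval (array_of B) i k == E_rowval a i k)]].

Lemma fittingP t (B : {set cell n}) : reflect
  (B \subset inner_from n t /\
   forall i k, t <= i -> E_rowval (array_of B) i k = E_rowval a i k)
  (B \in fitting t).
Proof.
rewrite inE; apply: (iffP andP) => [[-> /forallP H] | [-> H]]; split=> //.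
  move=> i k ti; have [Hi | Hi] := ltnP n i.
    by rewrite !E_rowval_small //; lia.
  have [Hk | Hk] := ltnP n k; first by rewrite !E_rowval_big.
  have /forallP/(_ (inord k))/implyP := H (inord i).
  by rewrite !inordK // => /(_ ti)/eqP.
by apply/forallP => i; apply/forallP => k; apply/implyP => ti; rewrite H.
Qed.

Lemma inner_from_inner t : inner_from n t \subset inner n.
Proof. by apply/subsetP => c; rewrite inE => /andP[]. Qed.

(** The southwest neighbor matches row [t] without column 0 with row [t.+1]. Since [B0] reproduces E
    of [a] below row [t], it also reproduces the contents there, by [C_rowval_eq]. *)
Lemma card_fiber_row t (B0 : {set cell n}) (k : 'I_n.+1) : 0 < t -> t < n ->
  B0 \in fitting t.+1 ->
  #|[set c in [set c in inner n | row_of c == t] |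
      inord (ev (array_of B0) t.+1 (col_of c).-1) == k]| = C_rowval a t.+1 k.
Proof.
move=> t0 tn /fittingP[B0s HE].
transitivity (C_rowval (array_of B0) t.+1 k); last first.
  exact: (@C_rowval_eq _ _ _ t.+1 _ (array_of_brg _)).
rewrite C_rowvalE //.
pose P j := (0 < j) && (ev (array_of B0) t.+1 j.-1 == k).
transitivity #|[set c : cell n | (row_of c == t) && P (col_of c)]|.
  apply: eq_card => c; rewrite !inE andbAC andbC; congr (_ && _).
  by rewrite -val_eqE /= inordK // ltnS ev_le.
rewrite card_row //; last lia.
by rewrite big_nat_recl // add0n -subSn // subSS.
Qed.

(** Forget the choices in row [t]. Over each [B0] in [fitting t.+1], an extension is a set [D] of
    cells of row [t] having, for each k, exactly [E_rowval a t k] cells with southwest neighbor k;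
    the number of these does not depend on [B0]. *)
Lemma card_fitting_step t : 0 < t -> t < n ->
  #|fitting t| =
  #|fitting t.+1| * \prod_(k < n.+1) 'C(C_rowval a t.+1 k, E_rowval a t k).
Proof.
move=> t0 tn; pose X := [set c in inner n | row_of c == t].
have restr (B : {set cell n}) :
    forall c, t.+1 <= row_of c -> B \subset inner n ->
    (c \in B :&: inner_from n t.+1) = (c \in B).
  move=> c tc /subsetP Bs; rewrite !inE tc andbT andbC.
  by case cB: (c \in B); rewrite ?andbF //= andbT; have := Bs c cB; rewrite inE.
have sub_inner s (B : {set cell n}) : B \subset inner_from n s -> B \subset inner n.
  by move=> HB; apply: subset_trans HB (inner_from_inner s).
rewrite -sum1_card.
rewrite (partition_big (fun B : {set cell n} => B :&: inner_from n t.+1) (mem (fitting t.+1)));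
    last first.
  move=> B /fittingP[Bs HE]; apply/fittingP; split; first exact: subsetIr.
  move=> i k ti; rewrite -HE; last exact: ltnW.
  by apply: (E_rowval_array_of_ext _ _ ti) => c tc; apply: restr (sub_inner _ _ Bs).
rewrite -sum_nat_const; apply: eq_bigr => B0 B0fit.
have /fittingP[B0s HE0] := B0fit.
pose v (c : cell n) : 'I_n.+1 := inord (ev (array_of B0) t.+1 (col_of c).-1).
transitivity (\prod_(k < n.+1)
    'C(#|[set c in X | v c == k]|, E_rowval a t k)); last first.
  by apply: eq_bigr => k _; rewrite (card_fiber_row k t0 tn B0fit).
rewrite -card_subset_fibers.
rewrite (reindex_onto (fun D : {set cell n} => B0 :|: D) (fun B => B :&: X)); last first.
  move=> B /andP[/fittingP[/subsetP Bs _] /eqP <-]; apply/setP => c.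
  rewrite !inE; case cB: (c \in B) => //=.
  by have := Bs c cB; rewrite !inE => /andP[-> /=]; case: ltngtP.
rewrite sum1dep_card; apply: eq_card => D; rewrite !inE.
have rowB0 c : c \in B0 -> (0 < col_of c) && (t < row_of c).
  by move/(subsetP B0s); rewrite !inE.
(* Row [t.+1] is already fixed by [B0], so E in row [t] counts the cells of [D] by their value under
   [v]. *)
have EX : (D \subset X) -> forall k : 'I_n.+1,
    E_rowval (array_of (B0 :|: D)) t k = #|[set c in D | v c == k]|.
  move=> /subsetP DX k.
  have agree c : t.+1 <= row_of c -> (c \in B0 :|: D) = (c \in B0).
    move=> tc; rewrite inE; case cD: (c \in D); last by rewrite orbF.
    by have := DX c cD; rewrite !inE; lia.
  rewrite E_rowval_array_of; last first.
    rewrite subUset (sub_inner _ _ B0s) /=; apply/subsetP => c /DX.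
    by rewrite inE => /andP[].
  apply: eq_card => c; rewrite !inE; case cD: (c \in D); rewrite ?orbF /=; last first.
    by case cB: (c \in B0) => //=; have := rowB0 c cB; lia.
  rewrite orbT; have := DX c cD; rewrite !inE => /andP[c0 /eqP ct].
  have cb := cell_bounds c.
  rewrite ct eqxx /= -val_eqE /= inordK ?ltnS ?ev_le //.
  by rewrite (ev_array_of_ext agree) //; lia.
apply/idP/idP.
  case/andP => /andP[HS /eqP HB0] /eqP HD.
  have DX : D \subset X by rewrite -HD subsetIr.
  have /fittingP[_ HE] : B0 :|: D \in fitting t by rewrite inE.
  by rewrite DX; apply/forallP => k; rewrite -(EX DX) HE.
case/andP => DX /forallP HD.
have notD c : t < row_of c -> c \notin D.
  by move=> tc; apply/negP => /(subsetP DX); rewrite !inE; lia.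
have agree c : t.+1 <= row_of c -> (c \in B0 :|: D) = (c \in B0).
  by move=> /notD; rewrite inE => /negbTE ->; rewrite orbF.
apply/andP; split; first (apply/andP; split); last 2 first.
- apply/eqP/setP => c; rewrite !inE.
  apply/idP/idP => [/andP[/orP[// | cD] /andP[_ tc]] | cB].
    by have := notD c tc; rewrite cD.
  by rewrite cB rowB0.
- apply/eqP/setP => c; rewrite !inE.
  apply/idP/idP => [/andP[/orP[/rowB0 | //]] | cD]; first lia.
  by have := subsetP DX c cD; rewrite !inE cD orbT.
suff : B0 :|: D \in fitting t by rewrite inE.
apply/fittingP; split.
  apply/subsetP => c; rewrite !inE => /orP[/rowB0 | /(subsetP DX)]; first lia.
  by rewrite !inE; lia.
move=> i k; rewrite leq_eqVlt => /orP[/eqP <- | ti]; last first.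
  by rewrite (E_rowval_array_of_ext _ agree ti) HE0.
have [Hk | Hk] := ltnP n k; first by rewrite !E_rowval_big.
by have := HD (inord k); rewrite -(EX DX) inordK // => /eqP.
Qed.

Lemma card_fitting t : 0 < t -> t <= n ->
  #|fitting t| = \prod_(t <= i < n) \prod_(k < n.+1)
                   'C(C_rowval a i.+1 k, E_rowval a i k).
Proof.
have [m] := ubnP (n - t); elim: m t => // m IH t Hm t0 tn.
move: tn; rewrite leq_eqVlt => /orP[/eqP tn | tn]; last first.
  by rewrite card_fitting_step // big_ltn // mulnC IH //; lia.
(* Row n has only column 0, so the empty choice is the only one. *)
rewrite big_geq ?tn //; apply/eqP/cards1P; exists set0; apply/setP => B.
rewrite in_set1; apply/fittingP/eqP => [[/subsetP BS _] | ->].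
  apply/setP => c; rewrite in_set0; apply/negP => /BS; rewrite !inE.
  by have := cell_bounds c; lia.
by split; [exact: sub0set | move=> i k ni; rewrite !E_rowval_small ?ni ?orbT].
Qed.

(* Row [i.+1] contains the value [n] at most once, so the factor [k = n] is a
   binomial coefficient 'C(1, _) or 'C(0, 0). *)
Lemma binom_trim i : 0 < i -> i < n ->
  \prod_(k < n.+1) 'C(C_rowval a i.+1 k, E_rowval a i k) =
  \prod_(i <= k < n) 'C(C_rowval a i.+1 k, E_rowval a i k).
Proof.
move=> i0 iltn.
rewrite -(big_mkord predT (fun k => 'C(C_rowval a i.+1 k, E_rowval a i k))).
rewrite big_nat_recr //= (@big_cat_nat _ _ _ i) //=; last exact: ltnW.
(* For k < i the factor is 1, since row i has no entry below i. *)
rewrite big_nat big1 ?mul1n => [|k Hk]; last first.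
  rewrite E_rowvalE // ?big_nat ?big1 ?bin0 //; last lia.
  by move=> j Hj; have := @Y_brg_green _ _ aY i j.+1 i0 ltac:(lia); lia.
have EC : E_rowval a i n <= C_rowval a i.+1 n.
  rewrite E_rowvalE ?C_rowvalE //; try lia; rewrite -subSn // subSS.
  by apply: leq_sum => j _; case: (ev a i.+1 j == n); rewrite ?andbF ?andbT ?leq_b1.
have C1 : C_rowval a i.+1 n <= 1.
  rewrite C_rowvalE // big_nat_recr //= big_nat big1 ?add0n ?leq_b1 // => j Hj.
  by have := @Y_brg_green _ _ aY i.+1 j isT ltac:(lia); lia.
by case: (C_rowval _ _ _) C1 EC => [|[|//]] _; case: (E_rowval _ _ _) => [|[|//]] // _;
   rewrite ?binn ?bin0 muln1.
Qed.

(** Through [eq_cells], row shuffles of [a] become the choices with the same E as [a]: equal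
    contents force equal E by [E_rowval_shuffle], and the converse is [C_rowval_eq]. *)
Lemma card_row_shuffle : 0 < n ->
  #|[set a' | row_shuffle a a']| = \prod_(1 <= i < n)
     \prod_(i <= k < n) 'C(C_rowval a i.+1 k, E_rowval a i k).
Proof.
move=> n0; transitivity #|fitting 1|; last first.
  rewrite card_fitting // !big_nat; apply: eq_bigr => i /andP[i0 iltn].
  by rewrite binom_trim.
have inner1 : inner_from n 1 = inner n.
  by apply/setP => c; rewrite inE; have /andP[-> _] := cell_bounds c; rewrite andbT.
have inj : {in [set a' | row_shuffle a a'] &, injective (@eq_cells n)}.
  move=> a1 a2; rewrite !inE => /row_shuffleP[_ Y1] /row_shuffleP[_ Y2] E.
  by rewrite -(eq_cellsK Y1) E eq_cellsK.
rewrite -(card_in_imset inj); apply: eq_card => B.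
apply/imsetP/fittingP => [[a'] | [Bs HE]].
  rewrite inE => /row_shuffleP[HC a'Y] ->; rewrite inner1 eq_cells_inner; split=> //.
  by move=> i k _; rewrite eq_cellsK //; apply: E_rowval_shuffle.
exists (array_of B); last by rewrite array_ofK // -inner1.
rewrite inE; apply/row_shuffleP; split; last exact: array_of_brg.
move=> i k; have [-> | i0] := posnP i; first by rewrite !C_rowval_small.
apply: (@C_rowval_eq _ _ _ 1) => //; first exact: array_of_brg.
by move=> i' k' Hi'; rewrite HE.
Qed.
End CountShuffles.

(** * Expansion of the products *)

Import GRing.Theory.
Local Open Scope ring_scope.

Lemma prod_fiber (R : comPzRingType) (T : finType) (A : {set T}) (f : T -> nat)
    m p (g : nat -> R) :
  (forall c, c \in A -> (m <= f c < p)%N) ->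
  \prod_(c in A) g (f c) =
  \prod_(m <= d < p) g d ^+ #|[set c in A | f c == d]|.
Proof.
move=> Hf; rewrite (big_fiber _ _ Hf); apply: eq_bigr => d _.
by rewrite -prodr_const; apply: eq_bigr => c; rewrite inE => /andP[_ /eqP ->].
Qed.

Lemma prod_pairs (R : comPzRingType) n (G : nat -> nat -> R) :
  \prod_(1 <= i < n.+1) \prod_(i.+1 <= j < n.+1) G i j =
  \prod_(c in inner n) G (row_of c) (row_of c + col_of c)%N.
Proof.
under [RHS]eq_bigl do rewrite inE.
rewrite [RHS](big_cell _ _ (fun i j => (0 < j)%N) (fun i j => G i (i + j)%N)).
apply: eq_bigr => i _; rewrite [RHS]big_mkcond [RHS]big_nat_recl //= mul1r.
rewrite -{1}[i.+1]add0n big_addn subSS.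
by apply: eq_bigr => j _ /=; congr (G i _); lia.
Qed.

(** [bigA_distr] expands over all subsets of [T]; extending [F] by 0 and [G] by 1 outside [A] kills
    the subsets not contained in [A] and preserves the other terms. *)
Lemma prod_addr_subsets (R : comPzRingType) (T : finType) (A : {set T})
    (F G : T -> R) :
  \prod_(c in A) (F c + G c) =
  \sum_(B : {set T} | B \subset A) (\prod_(c in B) F c * \prod_(c in A :\: B) G c).
Proof.
pose F' c := if c \in A then F c else 0.
pose G' c := if c \in A then G c else 1.
transitivity (\prod_c (F' c + G' c)).
  rewrite big_mkcond; apply: eq_bigr => c _; rewrite /F' /G'.
  by case: ifP; rewrite ?add0r.
rewrite bigA_distr [RHS]big_mkcond; apply: eq_bigr => B _.
rewrite (bigID (mem B)) /=; case: ifP => [/subsetP BA | /negbT /subsetPn[c cB cA]].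
  congr (_ * _); first by apply: eq_bigr => c cB; rewrite cB /F' BA.
  rewrite big_mkcond [RHS]big_mkcond; apply: eq_bigr => c _; rewrite inE /G'.
  by case: (c \in B).
by rewrite (bigD1 c cB) /= cB /F' (negbTE cA) !mul0r.
Qed.

Lemma weightE n (R : comPzRingType) (l : R) (x : nat -> R) (B : {set cell n}) :
  B \subset inner n ->
  \prod_(c in B) (l * x (row_of c + col_of c)%N) *
    \prod_(c in inner n :\: B) x (row_of c) =
  l ^+ #|B| *
  \prod_(1 <= i < n) x i ^+ (n - i - #|[set c in B | row_of c == i]|) *
  \prod_(2 <= d < n.+1) x d ^+ #|[set c in B | (row_of c + col_of c == d)%N]|.
Proof.
move=> Binner; rewrite big_split prodr_const /= -!mulrA; congr (_ * _).
have inside c : c \in B -> (0 < col_of c)%N.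
  by move/(subsetP Binner); rewrite inE.
rewrite mulrC; congr (_ * _); last first.
  apply: (@prod_fiber _ _ _ (fun c => row_of c + col_of c)%N) => c /inside Hc.
  by have := cell_bounds c; lia.
(* Row n has no inner cell, so the row index stops at n - 1. *)
rewrite (@prod_fiber _ _ _ (@row_of n) 1 n); last first.
  by move=> c; rewrite !inE => /andP[_ Hc]; have := cell_bounds c; lia.
rewrite !big_nat; apply: eq_bigr => i Hi; congr (_ ^+ _).
rewrite -(@card_inner_row n i); try lia.
have -> : [set c in inner n :\: B | row_of c == i] =
    [set c in inner n | row_of c == i] :\: [set c in B | row_of c == i].
  by apply/setP => c; rewrite !inE; case: (c \in B); case: (0 < _)%N; case: (row_of c == i).
rewrite cardsD (setIidPr _) //; apply/subsetP => c.
by rewrite !inE => /andP[/inside -> ->].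
Qed.

(** The ring and the values of [x] are left arbitrary so that [binomial_expansion] can take every
    x_i to be 1. *)
Lemma tournament_expansion n (R : comPzRingType) (l : R) (x : nat -> R) :
  \prod_(1 <= i < n.+1) \prod_(i.+1 <= j < n.+1) (x i + l * x j) =
  \sum_(a in Y_brg n) (l ^+ E_total a *
    \prod_(1 <= i < n) x i ^+ (n - i - E_row a i) *
    \prod_(2 <= d < n.+1) x d ^+ E_diag a d).
Proof.
rewrite (prod_pairs _ (fun i j => x i + l * x j)).
under eq_bigr do rewrite addrC.
rewrite prod_addr_subsets -sum_brg; apply: eq_bigr => a aY.
rewrite weightE ?eq_cells_inner // E_totalE.
congr (_ * _ * _); apply: eq_bigr => i _; rewrite ?E_rowE ?E_diagE //.
Qed.

Lemma row_shuffle_E n (a a' : array n) : a \in Y_brgy n -> row_shuffle a a' ->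
  forall i k, E_rowval a' i k = E_rowval a i k.
Proof.
move=> aY /row_shuffleP[HC a'Y] i k.
by apply: E_rowval_shuffle; rewrite // Y_brgy_sub.
Qed.

Lemma row_shuffle_E_row n (a a' : array n) i :
  a \in Y_brgy n -> row_shuffle a a' -> E_row a' i = E_row a i.
Proof. by move=> aY aa'; apply: eq_bigr => k _; apply: row_shuffle_E. Qed.

Lemma row_shuffle_E_total n (a a' : array n) :
  a \in Y_brgy n -> row_shuffle a a' -> E_total a' = E_total a.
Proof. by move=> aY aa'; apply: eq_bigr => i _; apply: row_shuffle_E_row. Qed.

Lemma binomial_expansion n (R : comPzRingType) (l : R) :
  (1 + l) ^+ 'C(n, 2) = \sum_(a in Y_brg n) l ^+ E_total a.
Proof.
transitivity (\prod_(1 <= i < n.+1) \prod_(i.+1 <= j < n.+1) (1 + l * 1)).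
  by rewrite (prod_pairs _ (fun _ _ => 1 + l * 1)) prodr_const card_inner mulr1.
rewrite (tournament_expansion n l (fun=> 1)); apply: eq_bigr => a _.
by rewrite !big1 ?mulr1 // => i _; rewrite expr1n.
Qed.

Theorem theorem19 (n : nat) (hn : (1 <= n)%N) :
  (\prod_(1 <= i < n.+1) \prod_(i.+1 <= j < n.+1) (x_ n i + lambda n * x_ n j)
   = \sum_(a in Y_brgy n)
       (lambda n ^+ E_total a *
        \prod_(1 <= i < n) (x_ n i ^+ (n - i - E_row a i)%N) *
        \sum_(a' : array n | row_shuffle a a')
          \prod_(2 <= d < n.+1) (x_ n d ^+ E_diag a' d)))
  /\
  ((1 + lambda n) ^+ 'C(n, 2)
   = \sum_(a in Y_brgy n)
       (lambda n ^+ E_total a *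
        \prod_(1 <= i < n) \prod_(i <= k < n)
          ('C(C_rowval a i.+1 k, E_rowval a i k))%:R)).
Proof.
split.
  rewrite (tournament_expansion n (lambda n) (x_ n)) -sum_row_shuffle.
  apply: eq_bigr => a aY; rewrite mulr_sumr; apply: eq_bigr => a' aa'.
  rewrite (row_shuffle_E_total aY aa'); congr (_ * _ * _).
  by apply: eq_bigr => i _; rewrite (row_shuffle_E_row _ aY aa').
rewrite binomial_expansion -sum_row_shuffle; apply: eq_bigr => a aY.
(* The power of [lambda] is constant among the shuffles of [a], so only their number remains. *)
transitivity (\sum_(a' | row_shuffle a a') lambda n ^+ E_total a).
  by apply: eq_bigr => a' aa'; rewrite (row_shuffle_E_total aY aa').
rewrite sumr_const -[#|_|]cardsE card_row_shuffle //; last exact: Y_brgy_sub.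
rewrite -mulr_natr natr_prod; congr (_ * _).
by apply: eq_bigr => i _; rewrite natr_prod.
Qed.
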